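(* 1. Let $(A,\Phi)$ be a two-dimensional $\ell$EAS. Then its only weak special vector is $0$. 2. Let $(\Omega,\star)$ be a semigroup. If $\Omega$ is a group or if $\Omega$ is finite, then the only weak special vector of the linearization of $\mathbf{EAS}(\Omega,\star)$ is $0$. 3. Let $(\Omega,\star)$ be a group and let $(A,\Phi)$ be the linearization of $\mathbf{EAS}'(\Omega,\star)$. Then the only weak special vector of $(A,\Phi)$ is $0$.
   Context: $\mathbb{K}$ is a field of characteristic zero and all vector spaces are over $\mathbb{K}$; $\tau$ is the flip of $A\otimes A$. An $\ell$EAS is a pair $(A,\Phi)$ with $A$ a vector space and $\Phi:A\otimes A\to A\otimes A$ linear such that $(\mathrm{Id}\otimes\Phi)\circ(\Phi\otimes\mathrm{Id})\circ(\mathrm{Id}\otimes\Phi)=(\Phi\otimes\mathrm{Id})\circ(\mathrm{Id}\otimes\tau)\circ(\Phi\otimes\mathrm{Id})$. A weak special vector of $(A,\Phi)$ is an element $a\in A$ such that $\Phi(a\otimes a)+\tau\circ\Phi(a\otimes a)=a\otimes a$. For an associative semigroup $(\Omega,\star)$, $\mathbf{EAS}(\Omega,\star)$ is the set $\Omega$ with the operations $\alpha\rightarrow\beta=\alpha\star\beta$ and $\alpha\triangleright\beta=\alpha$. For a group $(\Omega,\star)$, $\mathbf{EAS}'(\Omega,\star)$ is the set $\Omega$ with the operations $\alpha\rightarrow\beta=\beta$ and $\alpha\triangleright\beta=\alpha\star\beta^{\star-1}$, where $\beta^{\star-1}$ is the inverse of $\beta$. The linearization of $(\Omega,\rightarrow,\triangleright)$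 is the pair $(\mathbb{K}\Omega,\Phi)$, where $\mathbb{K}\Omega$ is the vector space with basis $\Omega$ and $\Phi(\alpha\otimes\beta)=(\alpha\rightarrow\beta)\otimes(\alpha\triangleright\beta)$ for $\alpha,\beta\in\Omega$. So $\Phi(\alpha\otimes\beta)=\alpha\star\beta\otimes\alpha$ in item 2 and $\Phi(\alpha\otimes\beta)=\beta\otimes\alpha\star\beta^{\star-1}$ in item 3. *)

(* Defs.v *)
From HB Require Import structures.
From mathcomp Require Import all_boot all_order all_algebra finmap.
From mathcomp Require Import sesquilinear ring_quotient monoid.
From mathcomp Require Import boolp classical_sets cardinality.
From mathcomp Require Import monalg.

Set Implicit Arguments.
Unset Strict Implicit.
Unset Printing Implicit Defensive.

Import GRing.Theory.
Local Open Scope ring_scope.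
Local Open Scope quotient_scope.

(* {malg K[T]} is the K-vector space with basis T, the basis vector attached
   to x : T being << x >>. *)
Section MalgLift.
Variables (K : fieldType) (T : choiceType) (W : lmodType K).

Definition malg_lift (h : T -> W) (g : {malg K[T]}) : W :=
  \sum_(k <- msupp g) g@_k *: h k.

Variable h : T -> W.

Lemma malg_liftEw (g : {malg K[T]}) (D : {fset T}) :
  (msupp g `<=` D)%fset -> malg_lift h g = \sum_(k <- D) g@_k *: h k.
Proof.
move=> sgD; rewrite /malg_lift (big_fset_incl _ sgD) // => k _ kg.
by rewrite mcoeff_outdom // scale0r.
Qed.

Lemma malg_lift_is_linear : linear (malg_lift h).
Proof.
move=> c x y.
pose D := (msupp (c *: x + y) `|` (msupp x `|` msupp y))%fset.
rewrite !(@malg_liftEw _ D) ?fsubsetUl //;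
  try by rewrite /D fsetUCA ?fsubsetUl // fsetUC fsetUA fsubsetUr.
- rewrite scaler_sumr -big_split /=; apply: eq_bigr => k _.
  by rewrite mcoeffD mcoeffZ scalerDl scalerA.
- by rewrite /D fsetUA fsubsetUr.
Qed.

HB.instance Definition _ :=
  GRing.isLinear.Build K {malg K[T]} W *:%R (malg_lift h) malg_lift_is_linear.

Lemma malg_liftU (x : T) : malg_lift h << x >> = h x.
Proof.
rewrite (@malg_liftEw _ [fset x]%fset) ?msuppU_le // big_seq_fset1.
by rewrite mcoeffUU scale1r.
Qed.

Lemma malg_lift_comb (h1 h2 : T -> W) (c : K) (g : {malg K[T]}) :
  (forall k, h k = c *: h1 k + h2 k) ->
  malg_lift h g = c *: malg_lift h1 g + malg_lift h2 g.
Proof.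
move=> hE; rewrite /malg_lift scaler_sumr -big_split /=.
by apply: eq_bigr => k _; rewrite hE scalerDr !scalerA mulrC.
Qed.

End MalgLift.

(* The tensor product A ⊗ B is the quotient of the free vector space on the set
   A * B by the subspace spanned by the bilinearity relations. *)
Section TensorDef.
Variables (K : fieldType) (A B : lmodType K).

Notation gen a b := (<< (a, b) >> : {malg K[(A * B)%type]}).

Inductive tensor_rel : {malg K[(A * B)%type]} -> Prop :=
| tensor_rel0 : tensor_rel 0
| tensor_relP c x y :
    tensor_rel x -> tensor_rel y -> tensor_rel (c *: x + y)
| tensor_rel_linl c a a' b :
    tensor_rel (gen (c *: a + a') b - (c *: gen a b + gen a' b))
| tensor_rel_linr c a b b' :
    tensor_rel (gen a (c *: b + b') - (c *: gen a b + gen a b')).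

Definition tensor_pred : {pred {malg K[(A * B)%type]}} :=
  fun x => `[< tensor_rel x >].

Lemma tensor_predP x : reflect (tensor_rel x) (x \in tensor_pred).
Proof. exact: asboolP. Qed.

Lemma tensor_pred_zmod_closed : zmod_closed tensor_pred.
Proof.
split=> [|x y /tensor_predP rx /tensor_predP ry]; apply/tensor_predP.
  exact: tensor_rel0.
by rewrite addrC -scaleN1r; apply: tensor_relP.
Qed.

HB.instance Definition _ :=
  GRing.isZmodClosed.Build {malg K[(A * B)%type]} tensor_pred
    tensor_pred_zmod_closed.

Definition tensor : Type := Quotient.quot tensor_pred.

HB.instance Definition _ := GRing.Zmodule.on tensor.
HB.instance Definition _ := EqQuotient.on tensor.

Lemma tensor_piD : {morph \pi_tensor : x y / x + y}.
Proof. exact: (@pi_addr _ _ _ _ _ (Quotient.quot tensor_pred)). Qed.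

Lemma tensor_piP (x y : {malg K[(A * B)%type]}) :
  reflect (\pi_tensor x = \pi_tensor y) (x - y \in tensor_pred).
Proof. by rewrite Quotient.idealrBE; exact: eqP. Qed.

Definition tensor_scale (c : K) (t : tensor) : tensor :=
  \pi_tensor (c *: repr t).

Lemma tensor_scale_pi c x : tensor_scale c (\pi_tensor x) = \pi_tensor (c *: x).
Proof.
apply/tensor_piP; rewrite -scalerBr; apply/tensor_predP.
rewrite -[_ *: _]addr0; apply: tensor_relP; last exact: tensor_rel0.
by apply/tensor_predP/tensor_piP; rewrite reprK.
Qed.

Lemma tensor_scaleA a b v :
  tensor_scale a (tensor_scale b v) = tensor_scale (a * b) v.
Proof.
by elim/quotW: v => v; rewrite (tensor_scale_pi b) !tensor_scale_pi scalerA.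
Qed.

Lemma tensor_scale1 : left_id 1 tensor_scale.
Proof. by elim/quotW => v; rewrite tensor_scale_pi scale1r. Qed.

Lemma tensor_scaleDr : right_distributive tensor_scale +%R.
Proof.
move=> c; elim/quotW => u; elim/quotW => v.
rewrite -tensor_piD !tensor_scale_pi.
by rewrite scalerDr tensor_piD.
Qed.

Lemma tensor_scaleDl v : {morph tensor_scale^~ v : a b / a + b}.
Proof.
by elim/quotW: v => v a b; rewrite !tensor_scale_pi scalerDl tensor_piD.
Qed.

HB.instance Definition _ := GRing.Zmodule_isLmodule.Build K tensor
  tensor_scaleA tensor_scale1 tensor_scaleDr tensor_scaleDl.

Lemma tensor_piZ c x : \pi_tensor (c *: x) = c *: \pi_tensor x.
Proof. by rewrite -tensor_scale_pi. Qed.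

Definition tens (a : A) (b : B) : tensor := \pi_tensor (gen a b).

Lemma tens_is_bilinear : bilinear_for
  (GRing.Scale.Law.clone _ _ *:%R _) (GRing.Scale.Law.clone _ _ *:%R _) tens.
Proof.
split=> [b|a] c x y /=; rewrite /tens -tensor_piZ -tensor_piD;
  apply/tensor_piP/tensor_predP.
- exact: tensor_rel_linl.
- exact: tensor_rel_linr.
Qed.

HB.instance Definition _ :=
  bilinear_isBilinear.Build K A B tensor _ _ tens tens_is_bilinear.

Lemma tensorE (t : tensor) :
  exists s : seq (K * (A * B)), t = \sum_(p <- s) p.1 *: tens p.2.1 p.2.2.
Proof.
rewrite -[t]reprK; set x := repr t.
exists [seq (x@_p, p) | p <- msupp x]; rewrite big_map {1}[x]monalgE.
have pi0 : \pi_tensor 0 = 0.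
  by apply: (addrI (\pi_tensor 0)); rewrite -tensor_piD !addr0.
rewrite (big_morph _ tensor_piD pi0); apply: eq_bigr => -[a b] _ /=.
rewrite /tens -tensor_piZ; congr (\pi_tensor _).
by apply/malgP => k; rewrite mcoeffZ !mcoeffU mulrnAr mulr1.
Qed.

End TensorDef.

Notation "A ⊗ B" := (tensor A B)
  (at level 40, left associativity) : type_scope.
Notation "a *t b" := (tens a b)
  (at level 40, left associativity) : ring_scope.

Section TensorLift.
Variables (K : fieldType) (A B W : lmodType K).

Definition tlift (f : {bilinear A -> B -> W}) (t : A ⊗ B) : W :=
  malg_lift (fun p => f p.1 p.2) (repr t).

Variable f : {bilinear A -> B -> W}.

Lemma tlift_pi x :
  tlift f (\pi_(A ⊗ B) x) = malg_lift (fun p => f p.1 p.2) x.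
Proof.
apply/eqP; rewrite -subr_eq0 -linearB /=; apply/eqP.
have : repr (\pi_(A ⊗ B) x) - x \in tensor_pred (A := A) (B := B).
  by apply/tensor_piP; rewrite reprK.
move=> /tensor_predP; elim => [|c u v _ Hu _ Hv|c a a' b|c a b b'].
- by rewrite linear0.
- by rewrite linearP /= Hu Hv scaler0 addr0.
- by rewrite linearB /= linearP /= !malg_liftU /= linearPl subrr.
- by rewrite linearB /= linearP /= !malg_liftU /= linearPr subrr.
Qed.

Lemma tlift_is_linear : linear (tlift f).
Proof.
move=> c; elim/quotW => u; elim/quotW => v; rewrite -tensor_piZ -tensor_piD !tlift_pi.
exact: linearP.
Qed.

HB.instance Definition _ :=
  GRing.isLinear.Build K (A ⊗ B) W *:%R (tlift f) tlift_is_linear.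

Lemma tliftE a b : tlift f (a *t b) = f a b.
Proof. by rewrite /tens tlift_pi malg_liftU. Qed.

Lemma tensor_linear_ext (g h : {linear A ⊗ B -> W}) :
  (forall a b, g (a *t b) = h (a *t b)) -> g =1 h.
Proof.
move=> gh t; have [s ->] := tensorE t; rewrite !linear_sum.
by apply: eq_bigr => p _; rewrite !linearZ gh.
Qed.

End TensorLift.

Lemma tlift_comb (K : fieldType) (A B W : lmodType K)
    (f g h : {bilinear A -> B -> W}) (c : K) (t : A ⊗ B) :
  (forall a b, f a b = c *: g a b + h a b) ->
  tlift f t = c *: tlift g t + tlift h t.
Proof.
by move=> fE; apply: malg_lift_comb => p; exact: fE.
Qed.

Section TensorMap.
Variables (K : fieldType) (A A' B B' : lmodType K).
Variables (f : {linear A -> A'}) (g : {linear B -> B'}).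

Definition tmap2 (a : A) (b : B) : A' ⊗ B' := f a *t g b.

Lemma tmap2_is_bilinear : bilinear_for
  (GRing.Scale.Law.clone _ _ *:%R _) (GRing.Scale.Law.clone _ _ *:%R _) tmap2.
Proof.
by split=> [b|a] c x y /=; rewrite /tmap2 linearP ?linearPl ?linearPr.
Qed.

HB.instance Definition _ := bilinear_isBilinear.Build K A B (A' ⊗ B') _ _
  tmap2 tmap2_is_bilinear.

Definition tmap : {linear A ⊗ B -> A' ⊗ B'} := tlift tmap2.

Lemma tmapE a b : tmap (a *t b) = f a *t g b.
Proof. exact: tliftE. Qed.

End TensorMap.

Section Flip.
Variables (K : fieldType) (A B : lmodType K).

Definition flip2 (a : A) (b : B) : B ⊗ A := b *t a.

Lemma flip2_is_bilinear : bilinear_for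
  (GRing.Scale.Law.clone _ _ *:%R _) (GRing.Scale.Law.clone _ _ *:%R _) flip2.
Proof. by split=> [b|a] c x y /=; rewrite /flip2 ?linearPl ?linearPr. Qed.

HB.instance Definition _ := bilinear_isBilinear.Build K A B (B ⊗ A) _ _
  flip2 flip2_is_bilinear.

Definition tflip : {linear A ⊗ B -> B ⊗ A} := tlift flip2.

Lemma tflipE a b : tflip (a *t b) = b *t a.
Proof. exact: tliftE. Qed.

End Flip.

Section Assoc.
Variables (K : fieldType) (A B C : lmodType K).

Definition assocl1 (c : C) (a : A) (b : B) : A ⊗ (B ⊗ C) := a *t (b *t c).

Lemma assocl1_is_bilinear c : bilinear_for
  (GRing.Scale.Law.clone _ _ *:%R _) (GRing.Scale.Law.clone _ _ *:%R _)
  (assocl1 c).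
Proof.
by split=> [b|a] k x y /=; rewrite /assocl1 linearPl // linearPr.
Qed.

HB.instance Definition _ c := bilinear_isBilinear.Build K A B (A ⊗ (B ⊗ C)) _ _
  (assocl1 c) (assocl1_is_bilinear c).

Definition assocl2 (t : A ⊗ B) (c : C) : A ⊗ (B ⊗ C) := tlift (assocl1 c) t.

Lemma assocl2_is_bilinear : bilinear_for
  (GRing.Scale.Law.clone _ _ *:%R _) (GRing.Scale.Law.clone _ _ *:%R _) assocl2.
Proof.
split=> [c|t] k x y /=; rewrite /assocl2; first exact: linearP.
by apply: tlift_comb => a b; rewrite /= /assocl1 !linearPr.
Qed.

HB.instance Definition _ := bilinear_isBilinear.Build K (A ⊗ B) C
  (A ⊗ (B ⊗ C)) _ _ assocl2 assocl2_is_bilinear.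

Definition tassoc : {linear (A ⊗ B) ⊗ C -> A ⊗ (B ⊗ C)} := tlift assocl2.

Lemma tassocE a b c : tassoc ((a *t b) *t c) = a *t (b *t c).
Proof. by rewrite /tassoc /= tliftE /= /assocl2 tliftE. Qed.

Definition assocr1 (a : A) (b : B) (c : C) : (A ⊗ B) ⊗ C := (a *t b) *t c.

Lemma assocr1_is_bilinear a : bilinear_for
  (GRing.Scale.Law.clone _ _ *:%R _) (GRing.Scale.Law.clone _ _ *:%R _)
  (assocr1 a).
Proof.
by split=> [c|b] k x y /=; rewrite /assocr1 linearPr // linearPl.
Qed.

HB.instance Definition _ a := bilinear_isBilinear.Build K B C ((A ⊗ B) ⊗ C) _ _
  (assocr1 a) (assocr1_is_bilinear a).

Definition assocr2 (a : A) (t : B ⊗ C) : (A ⊗ B) ⊗ C := tlift (assocr1 a) t.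

Lemma assocr2_is_bilinear : bilinear_for
  (GRing.Scale.Law.clone _ _ *:%R _) (GRing.Scale.Law.clone _ _ *:%R _) assocr2.
Proof.
split=> [t|a] k x y /=; rewrite /assocr2; last exact: linearP.
by apply: tlift_comb => b c; rewrite /= /assocr1 !linearPl.
Qed.

HB.instance Definition _ := bilinear_isBilinear.Build K A (B ⊗ C)
  ((A ⊗ B) ⊗ C) _ _ assocr2 assocr2_is_bilinear.

Definition tassocV : {linear A ⊗ (B ⊗ C) -> (A ⊗ B) ⊗ C} := tlift assocr2.

Lemma tassocVE a b c : tassocV (a *t (b *t c)) = (a *t b) *t c.
Proof. by rewrite /tassocV /= tliftE /= /assocr2 tliftE. Qed.

End Assoc.

Section LEAS.
Variables (K : fieldType) (A : lmodType K).
Implicit Type Phi : {linear A ⊗ A -> A ⊗ A}.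

(* A ⊗ A ⊗ A is taken to be A ⊗ (A ⊗ A). *)
Definition act12 Phi (t : A ⊗ (A ⊗ A)) : A ⊗ (A ⊗ A) :=
  tassoc A A A (tmap Phi (idfun : {linear A -> A}) (tassocV A A A t)).

Definition act23 Phi (t : A ⊗ (A ⊗ A)) : A ⊗ (A ⊗ A) :=
  tmap (idfun : {linear A -> A}) Phi t.

Definition is_lEAS Phi : Prop :=
  act23 Phi \o act12 Phi \o act23 Phi =1
  act12 Phi \o act23 (tflip A A) \o act12 Phi.

Definition weak_special Phi (a : A) : Prop :=
  Phi (a *t a) + tflip A A (Phi (a *t a)) = a *t a.

End LEAS.

Record binops (T : Type) := Binops { arr : T -> T -> T; tri : T -> T -> T }.

Definition EAS (S : semigroupType) : binops S :=
  Binops (fun a b => (a * b)%g) (fun a b => a).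

Definition EAS' (G : groupType) : binops G :=
  Binops (fun a b => b) (fun a b => (a * b^-1)%g).

Definition is_group (S : semigroupType) : Prop :=
  exists (e : S) (inv : S -> S),
    [/\ left_id e (fun x y : S => (x * y)%g),
        right_id e (fun x y : S => (x * y)%g),
        left_inverse e inv (fun x y : S => (x * y)%g) &
        right_inverse e inv (fun x y : S => (x * y)%g)].

Section Linearization.
Variables (K : fieldType) (T : choiceType) (O : binops T).
Notation KT := {malg K[T]}.

Definition lin2 (x y : KT) : KT ⊗ KT :=
  malg_lift (fun a =>
    malg_lift (fun b => << arr O a b >> *t << tri O a b >>) y) x.

Lemma lin2_is_bilinear : bilinear_for
  (GRing.Scale.Law.clone _ _ *:%R _) (GRing.Scale.Law.clone _ _ *:%R _) lin2.
Proof.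
split=> [y|x] c u v /=; rewrite /lin2; first exact: linearP.
by apply: malg_lift_comb => a; exact: linearP.
Qed.

HB.instance Definition _ := bilinear_isBilinear.Build K KT KT (KT ⊗ KT) _ _
  lin2 lin2_is_bilinear.

Definition linearization : {linear KT ⊗ KT -> KT ⊗ KT} := tlift lin2.

Lemma linearizationE a b :
  linearization (<< a >> *t << b >>) = << arr O a b >> *t << tri O a b >>.
Proof. by rewrite /linearization /= tliftE /= /lin2 !malg_liftU. Qed.

End Linearization.

(* Main.v *)
(* Item 1. If a <> 0, complete a to a basis (a, b). The weak special equation
   says Phi (a ⊗ a) = 1/2 a ⊗ a + l (a ⊗ b - b ⊗ a). The case l = 0 is excluded
   by evaluating the braid equation at a ⊗ a ⊗ a. Otherwise let x, y, s be the
   coefficients of b ⊗ b in Phi (a ⊗ b), of b ⊗ b in Phi (b ⊗ a) and of b ⊗ a in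
   Phi (b ⊗ a); three coefficients of the braid equation give (l + y) x = 0,
   l + 2 y = 2 x s and y^2 = 2 l x s, which force l = 0.

   Item 2. Let F(g) be the set of z in the support of a with g z = g. The
   coefficient of g ⊗ g gives 2 sum_(z in F(g)) a_z = a_g for g in the support.
   If z is in F(g) then F(z) is contained in F(g). So, when F(g) has minimal
   cardinality, F(z) = F(g) and hence a_z = a_g for all z in F(g), whence
   2 #F(g) a_g = a_g, which is absurd.

   Item 3. The coefficient of g ⊗ g gives 2 a_(g^2) = a_g for g in the support,
   so a takes the infinitely many values a_g / 2^k. *)

Require Import Defs.
From HB Require Import structures.
From mathcomp Require Import all_boot all_order all_algebra finmap.
From mathcomp Require Import monoid boolp classical_sets cardinality.
From mathcomp Require Import monalg.
From mathcomp Require Import sesquilinear ring.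

Set Implicit Arguments.
Unset Strict Implicit.
Unset Printing Implicit Defensive.

Import GRing.Theory.
Local Open Scope ring_scope.

(** * Linear forms f ⊗ g on a tensor product *)

Section TensorForm.
Variables (K : fieldType) (A B : lmodType K).
Variables (f : {linear A -> K^o}) (g : {linear B -> K^o}).

Definition tform2 (a : A) (b : B) : K^o := f a * g b.

Lemma tform2_is_bilinear : bilinear_for
  (GRing.Scale.Law.clone _ _ *:%R _) (GRing.Scale.Law.clone _ _ *:%R _) tform2.
Proof.
split=> [b|a] c x y /=; rewrite /tform2 linearP /= /GRing.scale /=; ring.
Qed.

HB.instance Definition _ := bilinear_isBilinear.Build K A B K^o _ _
  tform2 tform2_is_bilinear.

Definition tform : {linear A ⊗ B -> K^o} := tlift tform2.

Lemma tformE a b : tform (a *t b) = f a * g b.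
Proof. exact: tliftE. Qed.

End TensorForm.

Lemma tform_flip (K : fieldType) (A : lmodType K) (f g : {linear A -> K^o}) t :
  tform f g (tflip A A t) = tform g f t.
Proof.
apply: (tensor_linear_ext (g := tform f g \o tflip A A)) => a b /=.
by rewrite tflipE !tformE mulrC.
Qed.

(** Applying f ⊗ g turns the flip into an exchange of f and g, which leaves a scalar equation. *)
Lemma weak_special_form (K : fieldType) (A : lmodType K)
    (Phi : {linear A ⊗ A -> A ⊗ A}) (f g : {linear A -> K^o}) a :
  weak_special Phi a ->
  (tform f g (Phi (a *t a)) : K) + tform g f (Phi (a *t a)) = (f a : K) * g a.
Proof.
move=> /(congr1 (tform f g)); rewrite (linearD (tform f g)) tform_flip.
by rewrite tformE.
Qed.

(** * Coefficient forms on the free vector space K[T] *)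

Section MalgCoef.
Variables (K : fieldType) (T : choiceType).
Implicit Types (a : {malg K[T]}) (x : T).

Definition malg_coef x (a : {malg K[T]}) : K^o := a@_x.

Lemma malg_coef_is_linear x : linear (malg_coef x).
Proof. by move=> c a b; rewrite /malg_coef mcoeffD mcoeffZ. Qed.

HB.instance Definition _ x :=
  GRing.isLinear.Build K {malg K[T]} K^o *:%R (malg_coef x)
    (malg_coef_is_linear x).

Lemma linear_malg_lift (V W : lmodType K) (g : {linear V -> W}) (h : T -> V) a :
  g (malg_lift h a) = malg_lift (g \o h) a.
Proof.
by rewrite /malg_lift linear_sum; apply: eq_bigr => k _; rewrite linearZ.
Qed.

Lemma malg_supp0 a : (forall x, x \in msupp a -> False) -> a = 0.
Proof.
by move=> a0; apply/malgP => x; rewrite mcoeff0 mcoeff_outdom //; apply/negP/a0.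
Qed.

Lemma malg_coefU x y : malg_coef x << y >> = (y == x)%:R.
Proof. exact: mcoeffU. Qed.

Lemma sum_mcoeff_delta a x : \sum_(y <- msupp a) a@_y * (y == x)%:R = a@_x.
Proof.
rewrite [in RHS](monalgE a) raddf_sum; apply: eq_bigr => y _ /=.
by rewrite mcoeffU mulr_natr.
Qed.

(* The coefficient of x ⊗ x in the weak special equation. *)
Lemma weak_special_diag (O : binops T) a x :
  weak_special (linearization K O) a ->
  (\sum_(y <- msupp a) \sum_(z <- msupp a)
     a@_y * a@_z * ((arr O y z == x) && (tri O y z == x))%:R) *+ 2 = a@_x ^+ 2.
Proof.
move=> /(weak_special_form (malg_coef x) (malg_coef x)) spec_x.
rewrite expr2; apply: etrans spec_x; rewrite -mulr2n.
have -> : linearization K O (a *t a) = lin2 O a a by exact: tliftE.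
congr (_ *+ 2); rewrite /lin2 (linear_malg_lift (tform _ _)) /malg_lift.
apply: eq_bigr => y _.
rewrite /= (linear_malg_lift (tform _ _)) /malg_lift /GRing.scale /= mulr_sumr.
apply: eq_bigr => z _ /=; rewrite tformE /= !malg_coefU.
by rewrite -mulrA -mulnb natrM.
Qed.

End MalgCoef.

(** * Items 2 and 3: supports of weak special vectors in characteristic zero *)

Lemma char0_mulrn_eq0 (K : fieldType) (c : K) n :
  [pchar K] =i pred0 -> (c *+ n == 0) = (n == 0%N) || (c == 0).
Proof. by move=> /pcharf0P K0; rewrite -mulr_natr mulf_eq0 K0 orbC. Qed.

Lemma char0_mulrnI (K : fieldType) (c : K) :
  [pchar K] =i pred0 -> c != 0 -> injective (GRing.natmul c).
Proof.
move=> K0 c0 m n; wlog le_mn : m n / (m <= n)%N => [hw|].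
  by case/orP: (leq_total m n) => /hw // h /esym /h.
move=> /eqP; rewrite eq_sym -subr_eq0 -mulrnBr // char0_mulrn_eq0 //.
by rewrite (negPf c0) orbF subn_eq0 => le_nm; apply/eqP; rewrite eqn_leq le_mn.
Qed.

Section WeakSpecialEAS.
Variables (K : fieldType) (charK0 : [pchar K] =i pred0).

Section Semigroup.
Variables (S : semigroupType) (a : {malg K[S]}).
Hypothesis spec_a : weak_special (linearization K (EAS S)) a.

(** The set F(x) of item 2, as a finite set whose cardinality can be minimized. *)
Definition rstab x : {fset S} := [fset z in msupp a | (x * z)%g == x]%fset.

(** The pair (y, z) yields y z ⊗ y, so it reaches x ⊗ x only for y = x and z in F(x); the common
    factor a_x then cancels. *)
Lemma sum_rstab x : x \in msupp a -> (\sum_(z <- rstab x) a@_z) *+ 2 = a@_x.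
Proof.
rewrite -mcoeff_neq0 => ax0; apply: (mulfI ax0).
rewrite -expr2 -(weak_special_diag x spec_a) mulrnAr; congr (_ *+ 2).
rewrite -[a@_x](sum_mcoeff_delta a x) mulr_suml; apply: eq_bigr => y _.
rewrite big_fset /= mulr_sumr [LHS]big_mkcond /=.
apply: eq_bigr => z _; case: (eqVneq y x) => [->|_]; last first.
  by rewrite andbF !mulr0 mul0r if_same.
by rewrite andbT; case: ifP; rewrite ?mulr1 ?mulr0.
Qed.

(** If x z = x and z w = z, then x w = (x z) w = x (z w) = x z = x. *)
Lemma rstab_sub x z : z \in rstab x -> (rstab z `<=` rstab x)%fset.
Proof.
rewrite !inE /= => /andP[_ /eqP xz]; apply/fsubsetP => w; rewrite !inE /=.
by case/andP=> -> /eqP zw; rewrite -{1}xz -mulgA zw xz eqxx.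
Qed.

Lemma weak_special_EAS_eq0 : a = 0.
Proof.
apply: malg_supp0 => x0 x0a.
have [[x xa] _ /= min_x] := arg_minnP
  (fun x : msupp a => #|` rstab (val x)|) (isT : predT [` x0a]%fset).
have a_const z : z \in rstab x -> a@_z = a@_x.
  move=> xz; have za : z \in msupp a by move: xz; rewrite !inE => /andP[].
  (* One inclusion is [rstab_sub]; minimality of F(x) gives the cardinality bound that makes it an
     equality. *)
  have /eqP eq_zx : rstab z == rstab x.
    by rewrite eqEfcard rstab_sub //= (min_x [` za]%fset).
  by rewrite -(sum_rstab za) eq_zx sum_rstab.
have := sum_rstab xa; rewrite big_seq (eq_bigr (fun=> a@_x)) // -big_seq.
rewrite big_const_seq count_predT iter_addr_0 -mulrnA -[RHS]mulr1n.
have ax0 : a@_x != 0 by rewrite mcoeff_neq0.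
(* Cancelling a_x leaves 2 #F(x) = 1, which parity refutes. *)
by move/(char0_mulrnI charK0 ax0)/(congr1 odd); rewrite oddM andbF.
Qed.

End Semigroup.

Section Group.
Variables (G : groupType) (a : {malg K[G]}).
Hypothesis spec_a : weak_special (linearization K (EAS' G)) a.

(** The pair (y, z) yields z ⊗ y z^-1, so it reaches x ⊗ x only for z = x and y = x x; the common
    factor a_x then cancels. *)
Lemma mcoeff_sqr x : x \in msupp a -> a@_(x * x)%g *+ 2 = a@_x.
Proof.
rewrite -mcoeff_neq0 => ax0; apply: (mulfI ax0).
rewrite -expr2 -(weak_special_diag x spec_a) mulrnAr; congr (_ *+ 2).
rewrite -(sum_mcoeff_delta a (x * x)%g) mulr_sumr; apply: eq_bigr => y _.
rewrite -[a@_x](sum_mcoeff_delta a x) mulr_suml; apply: eq_bigr => z _ /=.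
case: (eqVneq z x) => [->|_]; last by rewrite !(mulr0, mul0r).
rewrite mulr1 mulrCA mulrA; congr (_ * _%:R) => /=.
by rewrite eq_sym (can2_eq (mulgK x) (mulgVK x)) eq_sym.
Qed.

Lemma weak_special_EAS'_eq0 : a = 0.
Proof.
apply: malg_supp0 => x xa.
(* The element [s k] is x^(2^k), and its coefficient will be a_x / 2^k. *)
pose s k := iter k (fun y : G => (y * y)%g) x.
have ax0 : a@_x != 0 by rewrite mcoeff_neq0.
have coef_s k : a@_(s k) *+ 2 ^ k = a@_x.
  elim: k => [|k IHk]; first exact: mulr1n.
  (* By the induction hypothesis [s k] is in the support, as [mcoeff_sqr] requires. *)
  rewrite expnS mulrnA mcoeff_sqr // -mcoeff_neq0; apply: contra_neq ax0 => sk0.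
  by rewrite -IHk sk0 mul0rn.
have s_supp k : s k \in msupp a.
  rewrite -mcoeff_neq0; apply: contra_neq ax0 => sk0.
  by rewrite -(coef_s k) sk0 mul0rn.
(* If s k = s l, their common nonzero coefficient c satisfies 2^k c = 2^l c, hence k = l. *)
have s_inj : injective s.
  move=> k l skl; have := coef_s k; rewrite -(coef_s l) -skl.
  have sk0 : a@_(s k) != 0 by rewrite mcoeff_neq0.
  by move/(char0_mulrnI charK0 sk0)/eqP; rewrite eqn_exp2l // => /eqP.
(* Pigeonhole: one more distinct element than the support can hold. *)
have s_sub : {subset map s (iota 0 (size (msupp a)).+1) <= msupp a}.
  by move=> _ /mapP[k _ ->].
have := uniq_leq_size _ s_sub.
by rewrite map_inj_uniq // iota_uniq size_map size_iota ltnn => /(_ isT).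
Qed.

End Group.
End WeakSpecialEAS.

(** * Item 1: the braid equation in structure constants *)

Section TensLinear.
Variables (K : fieldType) (A B : lmodType K).

(** The fixed factor comes first, so that [tensl y] is a linear map and sums can be pulled out of
    the left factor. *)
Definition tensl (y : B) (x : A) : A ⊗ B := x *t y.

Lemma tensl_is_linear y : linear (tensl y).
Proof. by move=> c x x'; rewrite /tensl linearPl. Qed.

HB.instance Definition _ y :=
  GRing.isLinear.Build K A (A ⊗ B) *:%R (tensl y) (tensl_is_linear y).

Lemma tens_is_linear (x : A) : linear (@tens K A B x).
Proof. by move=> c y y'; rewrite linearPr. Qed.

HB.instance Definition _ x :=
  GRing.isLinear.Build K B (A ⊗ B) *:%R (@tens K A B x) (tens_is_linear x).

Lemma tenslZ c x y : tensl y (c *: x) = c *: tensl y x.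
Proof. exact: linearZ. Qed.

Lemma tensZr c (x : A) (y : B) : x *t (c *: y) = c *: (x *t y).
Proof. exact: (linearZ_LR (@tens K A B x)). Qed.

End TensLinear.

Section ActLinear.
Variables (K : fieldType) (A : lmodType K) (Phi : {linear A ⊗ A -> A ⊗ A}).

Lemma act23E x t : act23 Phi (x *t t) = x *t Phi t.
Proof. exact: tmapE. Qed.

Lemma act12E x y z :
  act12 Phi (x *t (y *t z)) = tassoc A A A (Phi (x *t y) *t z).
Proof. by rewrite /act12 tassocVE; congr (tassoc A A A _); exact: tmapE. Qed.

Lemma act23_linear : linear (act23 Phi).
Proof. exact: linearP. Qed.

Lemma act12_linear : linear (act12 Phi).
Proof. by move=> c s t; rewrite /act12 !linearP. Qed.

HB.instance Definition _ :=
  GRing.isLinear.Build K (A ⊗ (A ⊗ A)) (A ⊗ (A ⊗ A)) *:%R (act23 Phi)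
    act23_linear.

HB.instance Definition _ :=
  GRing.isLinear.Build K (A ⊗ (A ⊗ A)) (A ⊗ (A ⊗ A)) *:%R (act12 Phi)
    act12_linear.

End ActLinear.

Lemma linear_sum2 (K : fieldType) (V W : lmodType K) (L : {linear V -> W})
    (I J : finType) (c : I -> J -> K) (t : I -> J -> V) :
  L (\sum_i \sum_j c i j *: t i j) = \sum_i \sum_j c i j *: L (t i j).
Proof.
rewrite linear_sum; apply: eq_bigr => i _; rewrite linear_sum.
by apply: eq_bigr => j _; rewrite linearZ.
Qed.

Lemma linear_sum2_comp (K : fieldType) (V1 V2 V3 W : lmodType K)
    (L1 : {linear V1 -> W}) (L2 : {linear V2 -> V1}) (L3 : {linear V3 -> V2})
    (I J : finType) (c : I -> J -> K) (t : I -> J -> V3) :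
  L1 (L2 (L3 (\sum_i \sum_j c i j *: t i j))) =
  \sum_i \sum_j c i j *: L1 (L2 (L3 (t i j))).
Proof. by rewrite !linear_sum2. Qed.

Section DualBasis.
Variables (K : fieldType) (A : lmodType K) (I : finType).
Variables (e : I -> A) (w : I -> {linear A -> K^o}).
Hypothesis decomp : forall x, x = \sum_i (w i x : K) *: e i.

Lemma tensor_decomp (t : A ⊗ A) :
  t = \sum_i \sum_j (tform (w i) (w j) t : K) *: (e i *t e j).
Proof.
have [s ->] := tensorE t.
elim/big_ind: _ => [|t1 t2 {1}-> {1}->|[c [x y]] _ /=].
- rewrite big1 // => i _; rewrite big1 // => j _.
  by rewrite (linear0 (tform _ _)) scale0r.
- rewrite -big_split; apply: eq_bigr => i _; rewrite -big_split.
  by apply: eq_bigr => j _; rewrite (linearD (tform _ _)) scalerDl.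
- rewrite -/(tensl y x) {1}[x]decomp (linear_sum (tensl y)) scaler_sumr.
  apply: eq_bigr => i _ /=; rewrite tenslZ /tensl {1}[y]decomp.
  rewrite (linear_sum (tens (e i))) !scaler_sumr; apply: eq_bigr => j _ /=.
  rewrite (linearZ_LR (tform _ _)) tformE tensZr /= !scalerA.
  by congr (_ *: _); rewrite /GRing.scale /=; ring.
Qed.

Hypothesis dual : forall i j, w i (e j) = (i == j)%:R :> K.

Variable Phi : {linear A ⊗ A -> A ⊗ A}.

(* The coefficient of e i ⊗ e j in Phi (e k ⊗ e l). *)
Definition sc i j k l : K := tform (w i) (w j) (Phi (e k *t e l)).

Definition tform3 i j k : {linear A ⊗ (A ⊗ A) -> K^o} :=
  tform (w i) (tform (w j) (w k)).

Lemma act23_basis x k l :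
  act23 Phi (x *t (e k *t e l)) =
  \sum_i \sum_j sc i j k l *: (x *t (e i *t e j)).
Proof.
rewrite act23E [Phi _]tensor_decomp.
rewrite (linear_sum (tens x)); apply: eq_bigr => i _.
rewrite (linear_sum (tens x)).
by apply: eq_bigr => j _ /=; rewrite tensZr.
Qed.

Lemma act12_basis k l z :
  act12 Phi (e k *t (e l *t z)) =
  \sum_i \sum_j sc i j k l *: (e i *t (e j *t z)).
Proof.
rewrite act12E [Phi _]tensor_decomp.
rewrite -/(tensl z _) (linear_sum (tensl z)) linear_sum; apply: eq_bigr => i _.
rewrite (linear_sum (tensl z)) linear_sum; apply: eq_bigr => j _.
by rewrite /= tenslZ linearZ /= /tensl tassocE.
Qed.

(** Used from right to left, it expands a coefficient into a sum that can be compared termwise with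
    a basis expansion. *)
Lemma sum_dual (c : I -> K) i : \sum_j c j * w i (e j) = c i.
Proof.
rewrite (bigD1 i) //= dual eqxx mulr1 big1 ?addr0 // => j j_i.
by rewrite dual eq_sym (negPf j_i) mulr0.
Qed.

Lemma tform3_act23 i g h l t :
  tform3 i g h (act23 Phi (e l *t t)) = w i (e l) * tform (w g) (w h) (Phi t).
Proof. by rewrite act23E /tform3 !tformE. Qed.

Lemma tform3_act12 i g h k l m :
  tform3 i g h (act12 Phi (e k *t (e l *t e m))) = sc i g k l * w h (e m).
Proof.
rewrite act12_basis linear_sum -[sc i g k l](sum_dual (fun p => sc p g k l)).
rewrite mulr_suml; apply: eq_bigr => p _.
rewrite linear_sum -[sc p g k l](sum_dual (fun q => sc p q k l)) !mulr_suml.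
apply: eq_bigr => q _; rewrite linearZ /= /tform3 !tformE /GRing.scale /=; ring.
Qed.

(** This is the coefficient of e i ⊗ e g ⊗ e h in the braid equation evaluated at e x ⊗ e y ⊗ e
    z. *)
Lemma lEAS_sc i g h x y z : is_lEAS Phi ->
  \sum_j \sum_k sc j k y z * (\sum_m sc i m x j * sc g h m k) =
  \sum_l sc l h x y * sc i g l z.
Proof.
move=> braid; pose t := e x *t (e y *t e z).
have LR : tform3 i g h (act23 Phi (act12 Phi (act23 Phi t))) =
    tform3 i g h (act12 Phi (act23 (tflip A A) (act12 Phi t))).
  by congr (tform3 i g h _); exact: (braid t).
have EL : tform3 i g h (act23 Phi (act12 Phi (act23 Phi t))) =
    \sum_j \sum_k sc j k y z *:
      tform3 i g h (act23 Phi (act12 Phi (e x *t (e j *t e k)))).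
  by rewrite /t act23_basis; exact: linear_sum2_comp.
have ER : tform3 i g h (act12 Phi (act23 (tflip A A) (act12 Phi t))) =
    \sum_j \sum_k sc j k x y *:
      tform3 i g h (act12 Phi (act23 (tflip A A) (e j *t (e k *t e z)))).
  by rewrite /t act12_basis; exact: linear_sum2_comp.
apply: etrans (etrans (etrans (esym EL) (etrans LR ER)) _).
  apply: eq_bigr => j _; apply: eq_bigr => k _; congr (_ * _).
  rewrite act12_basis (linear_sum2 (act23 Phi)) (linear_sum2 (tform3 i g h)).
  (* The inner sum now runs over the first tensor index, which duality fixes at [i]. *)
  rewrite exchange_big /=.
  apply: eq_bigr => m _.
  rewrite -[sc i m x j](sum_dual (fun q => sc q m x j)) mulr_suml.
  by apply: eq_bigr => q _; rewrite tform3_act23 -mulrA.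
apply: eq_bigr => l _.
rewrite -[sc l h x y](sum_dual (fun q => sc l q x y)) mulr_suml.
apply: eq_bigr => q _.
rewrite act23E tflipE tform3_act12 -mulrA; congr (_ * _); exact: mulrC.
Qed.

Lemma weak_special_sc i j k : weak_special Phi (e k) ->
  sc i j k k + sc j i k k = (i == k)%:R * (j == k)%:R.
Proof. by move=> /(weak_special_form (w i) (w j)) ->; rewrite !dual. Qed.

End DualBasis.

(** * Item 1: the two-dimensional case *)

Lemma dim2_dual_basis (K : fieldType) (A : vectType K) (a : A) :
  \dim {: A} = 2%N -> a != 0 ->
  exists (e : bool -> A) (w : bool -> {linear A -> K^o}),
    [/\ e false = a, forall x, x = \sum_i (w i x : K) *: e i &
        forall i j, w i (e j) = (i == j)%:R :> K].
Proof.
move=> dimA a0.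
have [b b_compl b0] : exists2 b, b \in (<[a]>^C)%VS & b != 0.
  (* The complement of the line of [a] has dimension 2 - 1 = 1, so the picked vector is nonzero. *)
  exists (vpick (<[a]>^C)%VS); first exact: memv_pick.
  by rewrite vpick0 -dimv_eq0 dimv_compl dimA dim_vline a0.
pose X := [tuple a; b].
have freeX : free X.
  rewrite free_cons seq1_free b0 andbT span_seq1; apply/negP => ab.
  have : a \in (<[a]> :&: <[a]>^C)%VS.
    by rewrite memv_cap memv_line; case/vlineP: ab => c {1}->; rewrite memvZ.
  by rewrite capv_compl memv0 (negPf a0).
have basisX : basis_of fullv X.
  by rewrite basisEfree freeX subvf dimA.
pose ix (i : bool) : 'I_2 := if i then 1 else 0.
exists (fun i => X`_(ix i)), (fun i => coord X (ix i)).
split=> [//|x|i j]; last first.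
  by apply: etrans (coord_free (ix j) (ix i) freeX) _; case: i; case: j.
rewrite big_bool {1}(coord_basis basisX (memvf x)) !big_ord_recl big_ord0.
rewrite addr0 addrC /=; congr (coord X _ x *: _ + _); exact: val_inj.
Qed.

Lemma weak_special0 (K : fieldType) (A : lmodType K)
    (Phi : {linear A ⊗ A -> A ⊗ A}) : weak_special Phi 0.
Proof.
have tens00 : (0 : A) *t (0 : A) = 0 by exact: (linear0 (@tens K A A 0)).
by rewrite /weak_special tens00 linear0 linear0 addr0.
Qed.

(* The index false stands for the weak special vector. *)
Lemma no_weak_special_sc2 (K : fieldType)
    (c : bool -> bool -> bool -> bool -> K) :
  [pchar K] =i pred0 ->
  (forall i j, c i j false false + c j i false false =
     (i == false)%:R * (j == false)%:R) ->
  ~ (forall i g h x y z,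
       \sum_j \sum_k c j k y z * (\sum_m c i m x j * c g h m k) =
       \sum_l c l h x y * c i g l z).
Proof.
move=> charK0 spec braid.
have two0 : 2%:R != 0 :> K by rewrite (pcharf0P K).1.
have half : c false false false false = 2%:R^-1.
  by apply: (mulfI two0); rewrite mulfV // mulr_natl mulr2n spec mul1r.
have bb0 : c true true false false = 0.
  by apply: (mulfI two0); rewrite mulr_natl mulr2n spec mul0r mulr0.
have ba : c true false false false = - c false true false false.
  by apply/eqP; rewrite -addr_eq0 addrC spec mulr0.
have braid0 i g h x y z :
    \sum_j \sum_k c j k y z * (\sum_m c i m x j * c g h m k) -
    \sum_l c l h x y * c i g l z = 0.
  by rewrite braid subrr.
set l := c false true false false in ba.
set x := c true true false true; set y := c true true true false.
set s := c true false true false.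
have l0 : l != 0.
  (* If l = 0, the coefficient of a ⊗ a ⊗ a at a ⊗ a ⊗ a reads 1/8 = 1/4. *)
  apply/eqP => l0; have := braid0 false false false false false false.
  rewrite !big_bool /= bb0 ba half -/l l0 => E.
  have /eqP : (2%:R^-1 ^+ 3 : K) = 0.
    by apply: etrans (etrans (congr1 -%R E) (oppr0 _)); field.
  by rewrite expf_eq0 invr_eq0 (negPf two0).
have D1 : (l + y) * x = 0.
  apply: (mulfI l0); rewrite mulr0.
  (* The coefficient of b ⊗ b ⊗ b at a ⊗ a ⊗ a is - l (l + y) x. *)
  have := braid0 true true true false false false.
  rewrite !big_bool /= bb0 ba half -/l -/x -/y => E.
  by apply: etrans (etrans (congr1 -%R E) (oppr0 _)); field.
have D2 : l + y *+ 2 = (x * s) *+ 2.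
  apply: (mulfI l0); apply/eqP; rewrite -subr_eq0; apply/eqP.
  (* Coefficient of b ⊗ b ⊗ a at a ⊗ a ⊗ a; the terms with the coefficient of b ⊗ a in Phi (a ⊗ b)
     cancel. *)
  have := braid0 true true false false false false.
  rewrite !big_bool /= bb0 ba half -/l -/x -/y -/s => E.
  by apply: etrans (etrans (congr1 (fun u => u * 2%:R) E) (mul0r _)); field.
have D3 : y ^+ 2 = (l * (x * s)) *+ 2.
  apply/eqP; rewrite -subr_eq0; apply/eqP.
  (* Coefficient of b ⊗ b ⊗ b at b ⊗ a ⊗ a; the terms with the coefficient of b ⊗ b in Phi (b ⊗ b)
     cancel. *)
  have := braid0 true true true true false false.
  rewrite !big_bool /= bb0 ba half -/l -/x -/y -/s => E.
  by apply: etrans (etrans (congr1 (fun u => - u * 2%:R) E) _); [field|ring].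
move/eqP: D1; rewrite mulf_eq0 addrC addr_eq0 => /orP[/eqP yl|/eqP x0].
  (* For y = - l, [D3] and [D2] give l^2 = l (l + 2 y) = - l^2. *)
  move: D3; rewrite -mulrnAr -D2 yl => /eqP.
  rewrite -subr_eq0 (_ : _ - _ = l ^+ 2 * 2%:R); last by ring.
  by rewrite mulf_eq0 (negPf two0) orbF expf_eq0 (negPf l0).
(* For x = 0, [D3] gives y = 0, and then [D2] gives l = 0. *)
move: D3; rewrite x0 mul0r mulr0 mul0rn => /eqP; rewrite expf_eq0 /= => /eqP y0.
by move: D2 l0; rewrite x0 y0 mul0r !mul0rn addr0 => ->; rewrite eqxx.
Qed.

Lemma weak_special_dim2_eq0 (K : fieldType) (charK0 : [pchar K] =i pred0)
    (A : vectType K) (Phi : {linear A ⊗ A -> A ⊗ A}) (a : A) :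
  \dim {: A} = 2%N -> is_lEAS Phi -> weak_special Phi a -> a = 0.
Proof.
move=> dimA braid spec_a; apply/eqP/negPn/negP => a0.
have [e [w [ea decomp dual]]] := dim2_dual_basis dimA a0.
rewrite -ea in spec_a.
have spec i j := weak_special_sc dual i j spec_a.
apply: (no_weak_special_sc2 charK0 spec) => i g h x y z.
exact: (lEAS_sc decomp dual).
Qed.

Theorem proposition3p7 (K : fieldType) (charK0 : [pchar K] =i pred0) :
  (forall (A : vectType K) (Phi : {linear A ⊗ A -> A ⊗ A}),
     \dim {: A} = 2%N -> is_lEAS Phi ->
     forall a : A, weak_special Phi a <-> a = 0)
  /\
  (forall S : semigroupType,
     is_group S \/ finite_set [set: S]%classic ->
     forall a : {malg K[S]},
       weak_special (linearization K (EAS S)) a <-> a = 0)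
  /\
  (forall (G : groupType) (a : {malg K[G]}),
     weak_special (linearization K (EAS' G)) a <-> a = 0).
Proof.
split=> [A Phi dimA braid a|]; last split=> [S _ a|G a].
- split=> [|->]; last exact: weak_special0.
  exact: weak_special_dim2_eq0.
- split=> [|->]; last exact: weak_special0.
  exact: weak_special_EAS_eq0.
- split=> [|->]; last exact: weak_special0.
  exact: weak_special_EAS'_eq0.
Qed.
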